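(* Let $s\ge2$ and $1\le d\le s$ be integers. The dual of the code $C_d$ is the code $C_{\Delta'}$ with respect to the Euclidean scalar product, i.e. $C_{\Delta'}=C_d^{\perp}$.
   Context: $\mathbb{F}_q$ is the finite field with $q$ elements, $q$ a power of a prime. Let $\Delta=\{(a_1,\dots,a_s): a_i\in\{0,1\},\ \sum_{i=1}^s a_i=d\}$. For $b=(b_1,\dots,b_s)\in\{0,1,\dots,q-2\}^s$ define $\widehat b=(\widehat{b_1},\dots,\widehat{b_s})\in\{0,1,\dots,q-2\}^s$ by $\widehat{b_i}=0$ if $b_i=0$ and $\widehat{b_i}=q-1-b_i$ if $b_i\ne0$. Put $\mathcal{G}=\{\widehat b: b\in\Delta\}$ and $\Delta'=\{0,1,\dots,q-2\}^s\setminus\mathcal{G}$. For a set $A$ of exponents, $E_A$ is the $\mathbb{F}_q$-span of the monomials $t^a=t_1^{a_1}\cdots t_s^{a_s}$, $a\in A$. Let $T=(\mathbb{F}_q^* )^s=\{P_1,\dots,P_m\}$, $m=(q-1)^s$, be the affine torus, and $ev_T:\mathbb{F}_q[t_1,\dots,t_s]\to\mathbb{F}_q^m$, $ev_T(f)=(f(P_1),\dots,f(P_m))$. Set $C_{\Delta'}=ev_T(E_{\Delta'})$ and $C_d=ev_T(E_\Delta)$ (the affine toric code of degree $d$ over the $d$-th hypersimplex). *)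

(* Defs.v *)
From HB Require Import structures.
From mathcomp Require Import all_boot all_order all_algebra.
From mathcomp Require Import mpoly.

Set Implicit Arguments.
Unset Strict Implicit.
Unset Printing Implicit Defensive.

Import GRing.Theory.
Local Open Scope ring_scope.

(* Sets of exponents, polynomials or words are Prop-valued predicates; the
   field F_q is F : finFieldType, with q = #|F|. *)

Section HypersimplexCode.

Variables (F : finFieldType) (s : nat).

Local Notation q := (#|F|).

Definition Delta (d : nat) (a : 'X_{1..s}) : Prop :=
  (forall i, a i = 0%N \/ a i = 1%N) /\ (\sum_(i < s) a i)%N = d.

(* Defined on all exponents: for q = 2 the elements of Delta lie outside
   {0, ..., q-2}^s, and the same formula then sends the exponent 1 to 0. *)
Definition hat (b : 'X_{1..s}) : 'X_{1..s} :=
  [multinom (if b i == 0 then 0 else q - 1 - b i)%N | i < s].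

Definition calG (d : nat) (a : 'X_{1..s}) : Prop :=
  exists2 b, Delta d b & a = hat b.

Definition Delta' (d : nat) (a : 'X_{1..s}) : Prop :=
  (forall i, (a i <= q - 2)%N) /\ ~ calG d a.

Definition monomial_span (A : 'X_{1..s} -> Prop) (f : {mpoly F[s]}) : Prop :=
  exists (r : seq 'X_{1..s}) (c : 'X_{1..s} -> F),
    (forall a, a \in r -> A a) /\ f = \sum_(a <- r) c a *: 'X_[a].

Definition torus : {set {ffun 'I_s -> F}} :=
  [set x : {ffun 'I_s -> F} | [forall i, x i != 0]].

Variable m : nat.

Definition ev (P : 'I_m -> {ffun 'I_s -> F}) (f : {mpoly F[s]}) : 'rV[F]_m :=
  \row_j f.@[P j].

Definition code (P : 'I_m -> {ffun 'I_s -> F}) (A : 'X_{1..s} -> Prop)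
    (v : 'rV[F]_m) : Prop :=
  exists2 f, monomial_span A f & v = ev P f.

Definition dual_code (C : 'rV[F]_m -> Prop) (v : 'rV[F]_m) : Prop :=
  forall w, C w -> \sum_j v 0 j * w 0 j = 0.

End HypersimplexCode.

Arguments Delta {s} d a.
Arguments Delta' F {s} d a.
Arguments torus F s : clear implicits.

(* Main.v *)
(** For an exponent vector k the sum of x^k over the torus vanishes unless q - 1
    divides every k_i; for a in the box {0, ..., q-2}^s and b in Delta, this
    divisibility for k = a + b forces a = hat b, so the code of Delta' is
    orthogonal to C_d.  Conversely, the discrete Fourier transform on the torus
    writes any word v as the evaluation of the polynomial supported on the box
    whose coefficient at a is, up to sign, the scalar product of v with the
    evaluation of t^(q-1-a).  At a = hat b this is the product with the
    evaluation of t^b, so it vanishes when v is orthogonal to C_d. *)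
Require Import Defs.
From HB Require Import structures.
From mathcomp Require Import all_boot all_order all_algebra.
From mathcomp Require Import finfield zify mpoly.

Set Implicit Arguments.
Unset Strict Implicit.
Unset Printing Implicit Defensive.

Local Open Scope ring_scope.

Import GRing.Theory.

Section PowerSums.

Variable F : finFieldType.

Lemma card_finField_sub1_gt0 : (0 < #|F| - 1)%N.
Proof. by rewrite subn_gt0 finNzRing_gt1. Qed.

Lemma natr_card_finField_sub1 : (#|F| - 1)%:R = -1 :> F.
Proof.
have F0 : #|F|%:R = 0 :> F.
  (* Translation by 1 permutes [F], so adding [#|F|%:R] does not change the sum of all elements. *)
  apply: (addrI (\sum_(x : F) x)).
  rewrite addr0 [RHS](reindex_inj (addIr (1 : F))) /= big_split /=.
  by rewrite sumr_const.
by rewrite natrB ?F0 ?sub0r // ltnW ?finNzRing_gt1.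
Qed.

Lemma expf_card_sub1 (x : F) : x != 0 -> x ^+ (#|F| - 1) = 1.
Proof.
move=> x0; apply: (mulfI x0).
by rewrite mulr1 -exprS subn1 prednK ?expf_card // ltnW ?finNzRing_gt1.
Qed.

(** Otherwise ['X^r - 1], with [r] the positive remainder of [k], would have all [#|F| - 1] units as
    roots, more than its degree. *)
Lemma dvdn_of_forall_expf_eq1 k :
  (forall x : F, x != 0 -> x ^+ k = 1) -> (#|F| - 1 %| k)%N.
Proof.
move=> xk1; set N := (#|F| - 1)%N; rewrite /dvdn; apply: contraT => r_neq0.
have r_gt0 : (0 < k %% N)%N by rewrite lt0n.
have := @max_poly_roots _ ('X^(k %% N) - 1) (enum [pred x : F | x != 0%R]).
rewrite -size_poly_eq0 size_XnsubC // enum_uniq => /(_ isT) max_roots.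
have : (#|[pred x : F | x != 0%R]| < (k %% N).+1)%N.
  rewrite cardE; apply: max_roots => //.
  apply/allP => x; rewrite mem_enum inE => x0.
  rewrite /root !hornerE ?hornerXn subr_eq0.
  have := xk1 x x0; rewrite {1}(divn_eq k N) exprD mulnC exprM.
  by rewrite expf_card_sub1 // expr1n mul1r => ->.
rewrite (_ : #|_| = N); last first.
  by rewrite /N subn1 -(cardC1 (0 : F)).
by rewrite ltnS leqNgt ltn_mod card_finField_sub1_gt0.
Qed.

(** Substituting [y * x] for [x] scales the sum by [y ^+ k], so a nonzero sum would force
    [y ^+ k = 1] for every unit [y]. *)
Lemma sum_expf_unit_eq0 k :
  ~~ (#|F| - 1 %| k)%N -> \sum_(x : F | x != 0) x ^+ k = 0.
Proof.
move=> ndvd; apply/eqP; apply: contraNT ndvd => S0.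
apply: dvdn_of_forall_expf_eq1 => y y0; apply: (mulIf S0).
rewrite mul1r mulr_sumr [RHS](reindex_inj (mulfI y0)) /=.
apply: eq_big => [x|x _]; last by rewrite exprMn.
by rewrite mulf_eq0 negb_or y0.
Qed.

Lemma sum_expf_lt_card_sub1 (z : F) : z != 0 ->
  \sum_(k < #|F| - 1) z ^+ k = - (z == 1)%:R.
Proof.
move=> z0; have [->|z1] := eqVneq.
  rewrite (eq_bigr (fun=> 1)) => [|k _]; last by rewrite expr1n.
  by rewrite sumr_const card_ord natr_card_finField_sub1.
have := subrX1 z (#|F| - 1); rewrite expf_card_sub1 // subrr => /esym/eqP.
by rewrite mulf_eq0 subr_eq0 (negPf z1) oppr0 => /eqP.
Qed.

End PowerSums.

Section Torus.

Variables (F : finFieldType) (s : nat).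

Lemma sum_torus_monomial (k : 'I_s -> nat) :
  \sum_(x in torus F s) \prod_i x i ^+ k i =
  \prod_(i < s) \sum_(y : F | y != 0) y ^+ k i.
Proof.
rewrite bigA_distr_big_dep; apply: eq_bigl => x.
rewrite inE; apply/forallP/familyP => x0 i; exact: x0.
Qed.

(** Where [b i = 0], [a i] is a multiple of [#|F| - 1] below it, hence 0; where [b i = 1], [a i + 1]
    lies between 1 and [#|F| - 1], hence equals the latter. *)
Lemma eq_hat_of_dvdn d (a b : 'X_{1..s}) :
  (forall i, (a i <= #|F| - 2)%N) -> Delta d b ->
  (forall i, (#|F| - 1 %| a i + b i)%N) -> a = hat F b.
Proof.
move=> a_le [b01 _] dvd_ab; apply/mnmP => i; rewrite mnmE.
have q_gt1 : (1 < #|F|)%N := finNzRing_gt1 F.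
have := dvd_ab i; have := a_le i; case: (b01 i) => -> /= le_a.
- by rewrite addn0 => /dvdnP[[|n]]; nia.
- by move=> /dvdnP[[|[|n]]]; nia.
Qed.

(** The exponents differ only where [b i = 0]: there the left one is [#|F| - 1], which acts as 0 on
    units. *)
Lemma expf_hat d (b : 'X_{1..s}) (x : 'I_s -> F) :
  (forall i, x i != 0) -> Delta d b ->
  \prod_i x i ^+ (#|F| - 1 - hat F b i) = \prod_i x i ^+ b i.
Proof.
move=> x0 [b01 _]; apply: eq_bigr => i _; rewrite mnmE.
case: (b01 i) => -> /=; first by rewrite subn0 expf_card_sub1.
by rewrite subKn ?card_finField_sub1_gt0.
Qed.

Definition box_exponent (a : {ffun 'I_s -> 'I_(#|F| - 1)}) : 'X_{1..s} :=
  [multinom val (a i) | i < s].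

(** The sum factors over the coordinates into geometric sums in [y i / x i], because
    [x i ^+ (#|F| - 1 - k)] is the inverse of [x i ^+ k]. *)
Lemma torus_orthogonality (x y : {ffun 'I_s -> F}) :
  x \in torus F s -> y \in torus F s ->
  \sum_a (\prod_i x i ^+ (#|F| - 1 - box_exponent a i)) *
         (\prod_i y i ^+ box_exponent a i) = (-1) ^+ s * (x == y)%:R.
Proof.
rewrite !inE => /forallP x0 /forallP y0.
have -> : (-1) ^+ s * (x == y)%:R = \prod_(i < s) - (y i / x i == 1)%:R :> F.
  rewrite prodrN card_ord; congr (_ * _).
  have [->|/eqP xy] := eqVneq x y.
    by rewrite big1 // => i _; rewrite divff ?eqxx.
  have [i xyi] : exists i, x i != y i.
    by apply/existsP; apply: contra_notT xy => /existsPn xy; apply/ffunP => i;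
       apply/eqP; have := xy i; rewrite negbK.
  rewrite (bigD1 i) //= -subr_eq0 -[1](divff (x0 i)) -mulrBl mulf_eq0.
  by rewrite invr_eq0 (negPf (x0 i)) orbF subr_eq0 eq_sym (negPf xyi) mul0r.
under [RHS]eq_bigr => i _.
  rewrite -sum_expf_lt_card_sub1; last by rewrite mulf_neq0 ?invr_eq0.
  over.
rewrite bigA_distr_bigA; apply: eq_bigr => a _; rewrite -big_split.
apply: eq_bigr => i _; rewrite mnmE /= expr_div_n mulrC; congr (_ * _).
by rewrite expfB ?expf_card_sub1 ?mul1r.
Qed.

Variables (m : nat) (P : 'I_m -> {ffun 'I_s -> F}).
Hypothesis P_torus : [set P j | j : 'I_m] = torus F s.

Lemma mem_torus j : P j \in torus F s.
Proof. by rewrite -P_torus imset_f. Qed.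

Lemma code_monomial (A : 'X_{1..s} -> Prop) a :
  A a -> code P A (ev P 'X_[a]).
Proof.
move=> Aa; exists 'X_[a] => //; exists [:: a], (fun=> 1); split.
  by move=> b; rewrite inE => /eqP->.
by rewrite big_seq1 scale1r.
Qed.

Hypothesis P_inj : injective P.

Lemma ev_monomial_orthogonal d a b : Delta' F d a -> Delta d b ->
  \sum_j ev P 'X_[a] 0 j * ev P 'X_[b] 0 j = 0.
Proof.
move=> [a_le aG] Db.
transitivity (\sum_(x in torus F s) \prod_i x i ^+ (a i + b i)).
  rewrite -P_torus big_imset /=; last by move=> ? ? _ _; exact: P_inj.
  apply: eq_bigr => j _; rewrite !mxE !mevalX -big_split.
  by apply: eq_bigr => i _; rewrite exprD.
rewrite sum_torus_monomial; apply/eqP; rewrite prodf_seq_eq0.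
(* If no coordinate factor vanishes, [#|F| - 1] divides every [a i + b i], which puts [a] in
   [calG]. *)
apply: contra_notT aG => /hasPn ndvd; exists b => //.
apply: (eq_hat_of_dvdn a_le Db) => i.
have := ndvd i (mem_index_enum i); apply: contraR => /sum_expf_unit_eq0 /= ->.
by rewrite eqxx.
Qed.

Lemma code_sub_dual d v :
  code P (Delta' F d) v -> dual_code (code P (Delta d)) v.
Proof.
move=> [_ [r [c [rD ->]]] ->] _ [_ [r' [c' [r'D ->]]] ->].
transitivity (\sum_j \sum_(a <- r) \sum_(b <- r')
   c a * c' b * (ev P 'X_[a] 0 j * ev P 'X_[b] 0 j)).
  apply: eq_bigr => j _; rewrite !mxE !raddf_sum mulr_suml.
  apply: eq_bigr => a _; rewrite mulr_sumr; apply: eq_bigr => b _.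
  by rewrite /= !mevalZ !mxE mulrACA.
rewrite exchange_big big1_seq // => a /= ar.
rewrite exchange_big big1_seq // => b /= br.
by rewrite -mulr_sumr (ev_monomial_orthogonal (rD a ar) (r'D b br)) mulr0.
Qed.

(** The sign is chosen to cancel the one in [torus_orthogonality]. *)
Definition fourier_coef (v : 'rV[F]_m) (a : 'X_{1..s}) : F :=
  (-1) ^+ s * \sum_j v 0 j * \prod_i P j i ^+ (#|F| - 1 - a i).

Lemma fourier_inversion v :
  v = ev P (\sum_a fourier_coef v (box_exponent a) *: 'X_[box_exponent a]).
Proof.
apply/rowP => k; rewrite mxE raddf_sum /=.
under eq_bigr => a _.
  rewrite mevalZ mevalX /fourier_coef mulr_sumr mulr_suml.
  under eq_bigr => j _ do rewrite -!mulrA.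
  over.
rewrite exchange_big /=; under eq_bigr => j _.
  rewrite -mulr_sumr -mulr_sumr torus_orthogonality ?mem_torus // inj_eq //.
  rewrite (mulrCA (v 0 j)) signrMK.
  over.
rewrite (bigD1 k) //= eqxx mulr1 big1 ?addr0 // => j /negPf->.
by rewrite mulr0.
Qed.

Lemma fourier_coef_dual d v a :
  dual_code (code P (Delta d)) v -> calG F d a -> fourier_coef v a = 0.
Proof.
move=> v_dual [b Db ->]; rewrite /fourier_coef.
rewrite -[X in _ * X](_ : \sum_j v 0 j * ev P 'X_[b] 0 j = _).
  by rewrite v_dual ?mulr0 //; exact: code_monomial.
apply: eq_bigr => j _; rewrite mxE mevalX (expf_hat _ Db) // => i.
by have := mem_torus j; rewrite inE => /forallP.
Qed.

Lemma dual_sub_code d v :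
  dual_code (code P (Delta d)) v -> code P (Delta' F d) v.
Proof.
move=> v_dual.
exists (\sum_a fourier_coef v (box_exponent a) *: 'X_[box_exponent a]);
  last exact: fourier_inversion.
(* Keeping only nonzero coefficients leaves the polynomial unchanged and discards every exponent of
   [calG], whose coefficient is 0 by duality. *)
exists [seq a <- [seq box_exponent a | a <- index_enum _] | fourier_coef v a != 0];
  exists (fourier_coef v); split.
  move=> b; rewrite mem_filter => /andP[cb /mapP[a _ eq_b]]; split.
    move=> i; rewrite eq_b mnmE -ltnS; apply: leq_trans (ltn_ord (a i)) _.
    by move: #|F| => n; lia.
  by move=> /(fourier_coef_dual v_dual) c0; rewrite c0 eqxx in cb.
rewrite big_filter big_map [RHS]big_rmcond // => a.
by rewrite negbK => /eqP->; rewrite scale0r.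
Qed.

End Torus.

Theorem theorem5p3 (F : finFieldType) (s d : nat)
    (P : 'I_((#|F| - 1) ^ s)%N -> {ffun 'I_s -> F}) :
  (2 <= s)%N -> (1 <= d <= s)%N ->
  injective P -> [set P j | j : 'I_((#|F| - 1) ^ s)%N] = torus F s ->
  forall v : 'rV[F]_((#|F| - 1) ^ s)%N,
    code P (Delta' F d) v <-> dual_code (code P (Delta d)) v.
Proof.
move=> _ _ P_inj P_torus v; split; [exact: code_sub_dual | exact: dual_sub_code].
Qed.
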